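(* Let $G=(V,E)$ be a finite simple graph of order $n\ge 1$ with minimum degree $\delta_n$. For every integer $k\in\{-\delta_n,\dots,0\}$, $$a_k(G)\le\left\lceil\frac{n+k+1}{2}\right\rceil .$$
   Context: For a set $X\subseteq V$ and $v\in V$, $\delta_X(v)$ denotes the number of neighbors of $v$ in $X$, and $\bar S=V\setminus S$. For an integer $k$, a nonempty set $S\subseteq V$ is a defensive $k$-alliance in $G$ if $\delta_S(v)\ge \delta_{\bar S}(v)+k$ for every $v\in S$. The defensive $k$-alliance number $a_k(G)$ is the minimum cardinality of a defensive $k$-alliance in $G$. *)

(* Defs.v *)
From HB Require Import structures.
From mathcomp Require Import all_boot all_order all_algebra.

Set Implicit Arguments.
Unset Strict Implicit.
Unset Printing Implicit Defensive.

Import Order.TTheory GRing.Theory Num.Theory.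

(* A finite simple graph is a finType of vertices with a symmetric,
   irreflexive adjacency relation; the definitions below only need the
   relation, and the two properties are hypotheses of the statement. *)

Definition deg_in (T : finType) (e : rel T) (X : {set T}) (v : T) : nat :=
  #|[set u in X | e v u]|.

Definition degree (T : finType) (e : rel T) (v : T) : nat :=
  deg_in e [set: T] v.

(* In an irreflexive graph every degree is less than #|T|, so the default
   value #|T| only shows up when there is no vertex. *)
Definition min_degree (T : finType) (e : rel T) : nat :=
  \big[minn/#|T|]_(v : T) degree e v.

Definition defensive_alliance (T : finType) (e : rel T) (k : int)
    (S : {set T}) : bool :=
  (S != set0) &&
  [forall v in S, ((deg_in e (~: S) v)%:Z + k <= (deg_in e S v)%:Z)%R].

(* The default value exceeds the cardinality of every set of vertices, so
   alliance_number e k = #|T|.+1 exactly when there is no defensive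
   k-alliance, and otherwise it is the minimum cardinality of one. *)
Definition alliance_number (T : finType) (e : rel T) (k : int) : nat :=
  \big[minn/#|T|.+1]_(S : {set T} | defensive_alliance e k S) #|S|.

(* Main.v *)
Require Import Defs.
From mathcomp Require Import all_boot all_order all_algebra.
From mathcomp Require Import zify.

Set Implicit Arguments.
Unset Strict Implicit.
Unset Printing Implicit Defensive.

Import Order.TTheory GRing.Theory Num.Theory.

(** The core is a duality for alliances ([alliance_dichotomy]): for every size
    s between 1 and n, the graph has a defensive k-alliance of size s or a
    defensive (1-k)-alliance of size n-s+1.  Let S have the least edge cut
    among the sets of size s, and suppose that a vertex v of S violates the
    k-alliance condition.  Put A = S \ {v}.  Adding a vertex u to A changes the
    cut by the excess d(u) of neighbours outside A over neighbours in A
    ([cut_setU1]); as S = A + v is optimal, v has the least excess d(v) among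
    all vertices outside A, and the violation says d(v) >= 1-k.  Hence the
    complement of A, which has n-s+1 vertices including v, is a (1-k)-alliance.

    When k <= 0 this alliance is stronger than required but may be too large.
    Deleting t vertices from it lowers, at each remaining vertex, the surplus
    of inner over outer neighbours by at most 2t ([alliance_sub]), so up to -k vertices can go at the price of
    descending from 1-k to 1+k, which still is at least k.  What is left has at
    most s vertices provided n-s+1+k <= s, that is, s >= (n+k+1)/2. *)

Section Alliances.

Variables (T : finType) (e : rel T).
Implicit Types (X Y Z A S : {set T}) (u v x : T) (k : int).

Lemma deg_in_sum X v : deg_in e X v = \sum_(u in X) e v u.
Proof.
rewrite /deg_in cardsE -sum1_card big_mkcond [RHS]big_mkcond.
by apply: eq_bigr => u _; rewrite unfold_in; case: (u \in X); case: (e v u).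
Qed.

Lemma deg_inID X Y v :
  deg_in e X v = deg_in e (X :&: Y) v + deg_in e (X :\: Y) v.
Proof. by rewrite !deg_in_sum (big_setID Y). Qed.

Lemma deg_in_setU1 X x v :
  x \notin X -> deg_in e (x |: X) v = e v x + deg_in e X v.
Proof. by move=> xX; rewrite !deg_in_sum big_setU1. Qed.

Lemma deg_in_setC1 A x v :
  x \notin A -> deg_in e (~: A) v = e v x + deg_in e (~: (x |: A)) v.
Proof.
move=> xA; rewrite -deg_in_setU1; last by rewrite !inE eqxx.
by rewrite setCU setUIr setUCr setTI (setUidPr _) // sub1set inE.
Qed.

Definition cut A : nat := \sum_(v in A) deg_in e (~: A) v.

(** The edges from x to A leave the cut, those from x to the rest enter it. *)
Lemma cut_setU1 A x : symmetric e -> irreflexive e -> x \notin A ->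
  cut (x |: A) + deg_in e A x = cut A + deg_in e (~: A) x.
Proof.
move=> e_sym e_irr xA; rewrite /cut big_setU1 //=.
rewrite (eq_bigr _ (fun v _ => deg_in_setC1 v xA)) big_split /=.
rewrite (deg_in_setC1 x xA) e_irr add0n.
rewrite (eq_bigr _ (fun v _ => congr1 nat_of_bool (e_sym v x))) -deg_in_sum.
lia.
Qed.

Lemma allianceP k S : reflect
  (S != set0 /\
   forall v, v \in S -> ((deg_in e (~: S) v)%:Z + k <= (deg_in e S v)%:Z)%R)
  (defensive_alliance e k S).
Proof. by apply: (iffP andP) => -[S0 /forall_inP HS]. Qed.

Lemma exists_subset_card X s :
  s <= #|X| -> exists2 Y : {set T}, Y \subset X & #|Y| = s.
Proof.
case/card_geqP => r [r_uniq r_size r_sub]; exists [set x in r].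
  by apply/subsetP => x; rewrite inE => /r_sub.
by rewrite cardsE -r_size; apply/card_uniqP.
Qed.

(** Exchanging v for u inside a cut-minimal set is best seen as adding either
    of them to A: the term for a possible edge between u and v then never
    appears, and u = v needs no separate treatment. *)
Lemma alliance_dichotomy k s : symmetric e -> irreflexive e -> 0 < s <= #|T| ->
  (exists2 S, defensive_alliance e k S & #|S| = s) \/
  (exists2 Y, defensive_alliance e (1 - k) Y & #|Y| = #|T| - s + 1).
Proof.
move=> e_sym e_irr /andP[s_gt0 s_le].
have [S0 _ S0s] : exists2 S0 : {set T}, S0 \subset [set: T] & #|S0| = s.
  by apply: exists_subset_card; rewrite cardsT.
have [S /eqP Ss cut_min] : exists2 S : {set T}, #|S| == s &
    forall X : {set T}, #|X| == s -> cut S <= cut X.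
  case: (@arg_minnP _ S0 (fun X => #|X| == s) cut) => [|S]; first exact/eqP.
  by exists S.
have [S_all|S_bad] := boolP (defensive_alliance e k S); [by left; exists S|right].
have S_neq0 : S != set0 by rewrite -card_gt0 Ss.
move: S_bad; rewrite negb_and S_neq0 => /forall_inPn[v vS v_bad].
pose A := S :\ v.
have vA : v \notin A by rewrite !inE eqxx.
have SE : v |: A = S by apply: setD1K.
have cardA : #|S| = #|A|.+1 by rewrite (cardsD1 v) vS.
have cardC : #|~: A| = #|T| - s + 1 by have := cardsC A; lia.
exists (~: A) => //; apply/allianceP; rewrite setCK.
split=> [|u]; first by rewrite -card_gt0 cardC addn1.
rewrite inE => uA.
have := cut_min (u |: A); rewrite cardsU1 uA add1n -cardA Ss eqxx => /(_ isT).
have := cut_setU1 e_sym e_irr vA; have := cut_setU1 e_sym e_irr uA.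
rewrite SE; move: v_bad; rewrite -{2}SE deg_in_setU1 // e_irr add0n.
rewrite -SE; have := deg_in_setC1 v vA; rewrite e_irr.
(* Comparing the two instances of cut_setU1 by the minimality of S, the excess
   of u over A is at least that of v, which exceeds -k. *)
lia.
Qed.

(** Each deleted vertex that is a neighbour of v passes from the inside count
    to the outside count, which lowers the difference of the two by 2. *)
Lemma alliance_sub (j k : int) Y Z :
    defensive_alliance e j Y -> Z \subset Y -> Z != set0 ->
    (k + (#|Y :\: Z|.*2)%:Z <= j)%R ->
  defensive_alliance e k Z.
Proof.
case/allianceP=> _ HY ZY Z0 le_kj; apply/allianceP; split=> // v vZ.
have := HY v (subsetP ZY v vZ).
have -> : deg_in e Y v = deg_in e Z v + deg_in e (Y :\: Z) v.
  by rewrite (deg_inID Y Z) (setIidPr ZY).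
have -> : deg_in e (~: Z) v = deg_in e (~: Y) v + deg_in e (Y :\: Z) v.
  have ZYC : ~: Y \subset ~: Z by rewrite setCS.
  by rewrite (deg_inID _ (~: Y)) (setIidPr ZYC) [~: Z :\: _]setDE setCK setIC -setDE.
have : deg_in e (Y :\: Z) v <= #|Y :\: Z|.
  by apply/subset_leq_card/subsetP => u; rewrite inE => /andP[].
lia.
Qed.

Lemma alliance_number_le k S :
  defensive_alliance e k S -> alliance_number e k <= #|S|.
Proof. by move=> HS; rewrite -leEnat /alliance_number -minEnat; exact: bigmin_le_cond. Qed.

Lemma exists_small_alliance k s : symmetric e -> irreflexive e ->
    (k <= 0)%R -> 0 < s <= #|T| -> (#|T|%:Z + k + 1 <= s.*2%:Z)%R ->
  exists2 S, defensive_alliance e k S & #|S| <= s.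
Proof.
move=> e_sym e_irr k_le s_bd s_large.
have [[S HS Ss]|[Y HY cardY]] := alliance_dichotomy k e_sym e_irr s_bd.
  by exists S; rewrite ?Ss.
have [Z ZY cardZ] := exists_subset_card (geq_minr s #|Y|).
(* The minimum covers the case where Y already has at most s vertices. *)
exists Z; last by rewrite cardZ geq_minl.
apply: (alliance_sub HY ZY); first by rewrite -card_gt0; lia.
by rewrite cardsDS //; lia.
Qed.

End Alliances.

Lemma min_degree_le_card (T : finType) (e : rel T) : min_degree e <= #|T|.
Proof. by rewrite -leEnat /min_degree -minEnat; exact: bigmin_le_id. Qed.

Theorem theorem6 (T : finType) (e : rel T)
    (e_sym : symmetric e) (e_irr : irreflexive e) (T_gt0 : (0 < #|T|)%N)
    (k : int) (k_ge : (- (min_degree e)%:Z <= k)%R) (k_le : (k <= 0)%R) :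
  ((alliance_number e k)%:Z
     <= Num.ceil (((#|T|)%:Z + k + 1)%:~R / 2 : rat))%R.
Proof.
have min_degree_le := min_degree_le_card e.
set c := Num.ceil _.
have c_large : (#|T|%:Z + k + 1 <= c * 2)%R.
  rewrite -(ler_int rat) intrM -ler_pdivrMr //; exact: ceil_ge.
(* The half of n+k+1 rounded up, as a natural number; since 1 <= n+k+1 <= n+1,
   it lies between 1 and n. *)
pose s := uphalf (absz (#|T|%:Z + k + 1)%R).
have [||S HS cardS] := @exists_small_alliance T e k s e_sym e_irr k_le.
- by rewrite /s; lia.
- by rewrite /s; lia.
have := alliance_number_le HS; move: cardS; rewrite /s; lia.
Qed.
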